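(* For $\alpha\in M_n(\mathbb{Z})^+$, the ring homomorphism $$\sigma_\alpha:\mathbb{Z}[q_1,\ldots,q_n,q_1^{-1},\ldots,q_n^{-1}]\to\mathbb{Z}[q_1,\ldots,q_n,q_1^{-1},\ldots,q_n^{-1}]$$ given by $\sigma_\alpha:q\mapsto q^\alpha$, where $q=(q_1,\ldots,q_n)$ and $q^\alpha=(q^\alpha_i)_{i=1,\ldots,n}$ with $q^\alpha_i=\prod_j q_j^{\alpha_{ij}}$, induces a ring homomorphism $$\sigma_\alpha:\widehat{\mathbb{Z}[q_1,\ldots,q_n]}\to\widehat{\mathbb{Z}[q_1,\ldots,q_n]}$$ of the multivariable Habiro ring.
   Context: $M_n(\mathbb{Z})^+$ is the multiplicative semigroup of integer $n\times n$ matrices with positive determinant. The multivariable Habiro ring is $\widehat{\mathbb{Z}[q_1,\ldots,q_n]}=\varprojlim_N\mathbb{Z}[q_1,\ldots,q_n]/I_{n,N}$, where $I_{n,N}$ is the ideal generated by the polynomials $(q_i-1)(q_i^2-1)\cdots(q_i^N-1)$, $i=1,\ldots,n$. Equivalently, it is $\varprojlim_N\mathbb{Z}[q_1,\ldots,q_n,q_1^{-1},\ldots,q_n^{-1}]/\mathcal{I}_{n,N}$, where $\mathcal{I}_{n,N}$ is the ideal of the Laurent polynomial ring generated by the same polynomials. *)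

(* Defs.v *)
From HB Require Import structures.
From mathcomp Require Import all_boot all_order all_algebra.
From mathcomp Require Import finmap.
From mathcomp Require monalg.
From mathcomp Require Import mpoly.
From mathcomp Require Import boolp.
From mathcomp Require Import ring.

Set Implicit Arguments.
Unset Strict Implicit.
Unset Printing Implicit Defensive.

Import Order.TTheory GRing.Theory Num.Theory.

Local Open Scope ring_scope.
Local Open Scope quotient_scope.

(* Classical inverses: every commutative ring is a comUnitRingType.  This is
   what gives a meaning to q_j ^ a for a negative integer a, both in the Laurent
   polynomial ring and in the Habiro ring. *)
Section ClassicalUnits.
Variable R : comNzRingType.

Definition cunit : {pred R} := fun x => `[< exists y, y * x = 1 >].

Definition cinv (x : R) : R :=
  if pselect (exists y, y * x = 1) is left h then projT1 (cid h) else x.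

Lemma cmulVx : {in cunit, left_inverse 1 cinv *%R}.
Proof.
move=> x /asboolP hx; rewrite /cinv.
by case: pselect => // h; case: (cid h).
Qed.

Lemma cunitP (x y : R) : y * x = 1 -> cunit x.
Proof. by move=> h; apply/asboolP; exists y. Qed.

Lemma cinv_out : {in [predC cunit], cinv =1 id}.
Proof.
by move=> x /negP hx; rewrite /cinv; case: pselect => // h; case: hx; apply/asboolP.
Qed.

End ClassicalUnits.

(* Z[q_1^{+-1}, ..., q_n^{+-1}] is the group ring of Z^n: a Laurent polynomial is
   a finitely supported function from exponent vectors to coefficients.
   The library makes {malg R[K]} a ring only for monoids K without nontrivial
   invertible elements, so that the convolution product is defined here. *)
Section LaurentRing.
Import monalg.
Local Notation "g @_ k" := (mcoeff k g) : ring_scope.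
Variable n : nat.

Definition laurent : Type := {malg int['rV[int]_n]}.

HB.instance Definition _ := GRing.Zmodule.on laurent.

Implicit Types (g : {malg int['rV[int]_n]}) (k : 'rV[int]_n) (c : int).

Definition laurent_one : {malg int['rV[int]_n]} := << 1 *g (0 : 'rV[int]_n) >>.

Definition laurent_mul g1 g2 : {malg int['rV[int]_n]} :=
  \sum_(k1 <- msupp g1) \sum_(k2 <- msupp g2) << g1@_k1 * g2@_k2 *g k1 + k2 >>.

Local Notation lmul := laurent_mul.

Lemma laurent_mulw (d1 d2 : {fset 'rV[int]_n}) g1 g2 :
  (msupp g1 `<=` d1)%fset -> (msupp g2 `<=` d2)%fset ->
  lmul g1 g2
  = \sum_(k1 <- d1) \sum_(k2 <- d2) << g1@_k1 * g2@_k2 *g k1 + k2 >>.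
Proof.
move=> le_d1 le_d2; rewrite /lmul (big_fset_incl _ le_d1) /=.
  apply/eq_bigr=> k1 _; apply/big_fset_incl => // k _ /mcoeff_outdom ->.
  by rewrite mulr0 monalgU0.
move=> k _ /mcoeff_outdom g1k.
by rewrite big1 => // k' _; rewrite g1k mul0r monalgU0.
Qed.

Lemma laurent_mulUU c1 c2 k1 k2 :
  lmul << c1 *g k1 >> << c2 *g k2 >> = << c1 * c2 *g k1 + k2 >>.
Proof.
by rewrite (laurent_mulw (@msuppU_le _ _ _ _) (@msuppU_le _ _ _ _))
           !big_seq_fset1 !mcoeffUU.
Qed.

Lemma laurent_mulC : commutative lmul.
Proof.
move=> g1 g2; rewrite /lmul exchange_big /=; apply/eq_bigr => k1 _.
by apply/eq_bigr => k2 _; rewrite mulrC addrC.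
Qed.

Lemma laurent_mulDl : left_distributive lmul +%R.
Proof.
move=> g1 g2 g.
rewrite (@laurent_mulw _ _ g1 g (fsubsetUl _ (msupp g2)) (fsubset_refl _)).
rewrite (@laurent_mulw _ _ g2 g (fsubsetUr (msupp g1) _) (fsubset_refl _)).
rewrite (@laurent_mulw _ _ (g1 + g2) g (msuppD_le _ _) (fsubset_refl _)).
rewrite -big_split /=; apply/eq_bigr=> k1 _.
rewrite -big_split /=; apply/eq_bigr=> k2 _.
by rewrite mcoeffD mulrDl monalgUD.
Qed.

Lemma laurent_mulDr : right_distributive lmul +%R.
Proof. by move=> g g1 g2; rewrite ![lmul g _]laurent_mulC laurent_mulDl. Qed.

Lemma laurent_mul0g : left_zero 0 lmul.
Proof. by move=> g; rewrite /lmul msupp0 big_seq_fset0. Qed.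

Lemma laurent_mulg0 : right_zero 0 lmul.
Proof. by move=> g; rewrite laurent_mulC laurent_mul0g. Qed.

Lemma laurent_mul1g : left_id laurent_one lmul.
Proof.
move=> g; rewrite (laurent_mulw (@msuppU_le _ _ _ _) (fsubset_refl _)).
rewrite big_seq_fset1 [RHS]monalgE.
by apply/eq_bigr=> k _; rewrite mcoeffUU mul1r add0r.
Qed.

Lemma laurent_mul_suml (I : Type) (r : seq I) (F : I -> {malg int['rV[int]_n]}) g :
  lmul (\sum_(i <- r) F i) g = \sum_(i <- r) lmul (F i) g.
Proof.
exact: (big_morph (lmul^~ g) (fun _ _ => laurent_mulDl _ _ _) (laurent_mul0g _)).
Qed.

Lemma laurent_mul_sumr (I : Type) (r : seq I) (F : I -> {malg int['rV[int]_n]}) g :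
  lmul g (\sum_(i <- r) F i) = \sum_(i <- r) lmul g (F i).
Proof.
exact: (big_morph (lmul g) (fun _ _ => laurent_mulDr _ _ _) (laurent_mulg0 _)).
Qed.

Lemma laurent_mulEl g1 g2 :
  lmul g1 g2 = \sum_(k <- msupp g1) lmul << g1@_k *g k >> g2.
Proof. by rewrite {1}[g1]monalgE laurent_mul_suml. Qed.

Lemma laurent_mulEr g1 g2 :
  lmul g1 g2 = \sum_(k <- msupp g2) lmul g1 << g2@_k *g k >>.
Proof. by rewrite {1}[g2]monalgE laurent_mul_sumr. Qed.

Lemma laurent_mulUUA c1 c2 k1 k2 g :
  lmul << c1 *g k1 >> (lmul << c2 *g k2 >> g) =
  lmul (lmul << c1 *g k1 >> << c2 *g k2 >>) g.
Proof.
have := laurent_mulUU; have := laurent_mul_sumr; have := laurent_mulEr.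
move: laurent_mul => mul; set U := fun c k => << c *g k >>.
rewrite -[<< c1 *g k1 >>]/(U c1 k1) -[<< c2 *g k2 >>]/(U c2 k2).
move=> Er sumr UU.
have {}Er g1 g2 : mul g1 g2 = \sum_(k <- msupp g2) mul g1 (U g2@_k k) by exact: Er.
have {}UU c c' k k' : mul (U c k) (U c' k') = U (c * c') (k + k') by exact: UU.
move: U => U in Er UU *; rewrite UU [RHS]Er [X in mul _ X]Er sumr.
by apply: eq_bigr => k3 _; rewrite !UU mulrA addrA.
Qed.

Lemma laurent_mulA : associative lmul.
Proof.
move=> g1 g2 g3; rewrite laurent_mulEl (laurent_mulEl g1 g2) laurent_mul_suml.
apply: eq_bigr => k1 _; move: g1@_k1 => c1.
rewrite [X in lmul _ X]laurent_mulEl laurent_mul_sumr.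
rewrite [X in lmul X g3]laurent_mulEr laurent_mul_suml.
by apply: eq_bigr => k2 _; apply: laurent_mulUUA.
Qed.

Lemma laurent_oner_neq0 : laurent_one != 0.
Proof.
apply/eqP => /(congr1 (mcoeff (0 : 'rV[int]_n))).
by rewrite mcoeffUU mcoeff0.
Qed.

HB.instance Definition _ := GRing.Zmodule_isComNzRing.Build laurent
  laurent_mulA laurent_mulC laurent_mul1g laurent_mulDl laurent_oner_neq0.

HB.instance Definition _ := GRing.ComNzRing_hasMulInverse.Build laurent
  (@cmulVx laurent) (@cunitP laurent) (@cinv_out laurent).

Definition lmonom (k : 'rV[int]_n) : laurent := << 1 *g k >>.

Definition lvar (i : 'I_n) : laurent := lmonom (delta_mx 0 i).

Definition leval (S : comUnitRingType) (v : 'I_n -> S) (g : laurent) : S :=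
  \sum_(k <- msupp g) (\prod_i v i ^ k 0 i) *~ g@_k.

Section Leval.
Variables (S : comUnitRingType) (v : 'I_n -> S).

Lemma leval_zmod_morphism : zmod_morphism (leval v).
Proof.
have levalE (d : {fset 'rV[int]_n}) (g : laurent) : (msupp g `<=` d)%fset ->
    leval v g = \sum_(k <- d) (\prod_i v i ^ k 0 i) *~ g@_k.
  move=> le; rewrite /leval (big_fset_incl _ le) //= => k _ /mcoeff_outdom ->.
  by rewrite mulr0z.
move=> g1 g2; set d := (msupp g1 `|` msupp g2)%fset.
rewrite (levalE d (g1 - g2)) ?msuppB_le // (levalE d g1) ?fsubsetUl //.
rewrite (levalE d g2) ?fsubsetUr // -sumrB; apply: eq_bigr => k _.
by rewrite mcoeffB mulrzBr.
Qed.

HB.instance Definition _ :=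
  GRing.isZmodMorphism.Build laurent S (leval v) leval_zmod_morphism.

Lemma levalU c k : leval v << c *g k >> = (\prod_i v i ^ k 0 i) *~ c.
Proof.
rewrite /leval msuppU; case: eqP => [->|_]; first by rewrite big_seq_fset0 mulr0z.
by rewrite big_seq_fset1 mcoeffUU.
Qed.

Lemma leval_lmonom k : leval v (lmonom k) = \prod_i v i ^ k 0 i.
Proof. by rewrite levalU mulr1z. Qed.

Lemma leval_lvar i : leval v (lvar i) = v i.
Proof.
rewrite leval_lmonom (bigD1 i) //= mxE !eqxx expr1z big1 ?mulr1 // => j /negPf ne.
by rewrite mxE eqxx ne expr0z.
Qed.

(* Without this hypothesis, v i ^ a with a < 0 involves a junk inverse. *)
Hypothesis vU : forall i, v i \is a GRing.unit.

Lemma leval_monoid_morphism : monoid_morphism (leval v).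
Proof.
split.
  rewrite [1]/(<< 1 *g (0 : 'rV[int]_n) >> : laurent) leval_lmonom.
  by rewrite big1 // => i _; rewrite mxE expr0z.
move=> g1 g2; rewrite [g1 * g2]/(laurent_mul g1 g2).
rewrite /laurent_mul raddf_sum {2}/leval mulr_suml; apply: eq_bigr => k1 _.
rewrite raddf_sum mulr_sumr; apply: eq_bigr => k2 _.
rewrite /= levalU mulrzAl mulrzAr -mulrzA [X in _ *~ X]mulrC; congr (_ *~ _).
rewrite -big_split; apply: eq_bigr => i _ /=.
by rewrite mxE exprzDr.
Qed.

End Leval.

Lemma lmonomD k1 k2 : lmonom (k1 + k2) = lmonom k1 * lmonom k2.
Proof. by rewrite [RHS]laurent_mulUU mulr1. Qed.

Lemma lmonom0 : lmonom 0 = 1. Proof. by []. Qed.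

Lemma lmonom_unit k : lmonom k \is a GRing.unit.
Proof. by apply/asboolP; exists (lmonom (- k)); rewrite -lmonomD addNr. Qed.

Lemma lvar_unit i : lvar i \is a GRing.unit.
Proof. exact: lmonom_unit. Qed.

Lemma lmonomMz k (z : int) : lmonom (z *: k) = lmonom k ^ z.
Proof.
have natP (m : nat) : lmonom (m%:Z *: k) = lmonom k ^+ m.
  elim: m => [|m IH]; first by rewrite scale0r.
  by rewrite intS scalerDl scale1r lmonomD IH exprS.
case: (intP z) => [|m|m]; rewrite ?natP //.
apply: (mulIr (lmonom_unit (m.+1%:Z *: k))).
rewrite -lmonomD scaleNr addNr lmonom0 natP -invr_expz.
by rewrite mulVr // unitrX // lmonom_unit.
Qed.

Lemma lmonomE k : lmonom k = \prod_i lvar i ^ k 0 i.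
Proof.
rewrite {1}[k]row_sum_delta (big_morph lmonom lmonomD lmonom0).
by apply: eq_bigr => i _; rewrite lmonomMz.
Qed.

(* For alpha : 'M[int]_n, the i-th component of q^alpha. *)
Definition qpow (alpha : 'M[int]_n) (i : 'I_n) : laurent :=
  \prod_j lvar j ^ alpha i j.

Lemma qpow_unit alpha i : qpow alpha i \is a GRing.unit.
Proof. by rewrite rpred_prod // => j _; rewrite unitrXz ?lvar_unit. Qed.

Definition sigma (alpha : 'M[int]_n) : laurent -> laurent := leval (qpow alpha).

HB.instance Definition _ alpha := GRing.Additive.on (sigma alpha).
HB.instance Definition _ alpha :=
  GRing.isMonoidMorphism.Build laurent laurent (sigma alpha)
    (leval_monoid_morphism (qpow_unit alpha)).

Lemma sigma_lvar alpha i : sigma alpha (lvar i) = \prod_j lvar j ^ alpha i j.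
Proof. exact: leval_lvar. Qed.

End LaurentRing.

Section HabiroIdeal.
Variable n : nat.

Definition habiro_gen (N : nat) (i : 'I_n) : {mpoly int[n]} :=
  \prod_(1 <= k < N.+1) ('X_i ^+ k - 1).

Definition habiro_ideal (N : nat) : {pred {mpoly int[n]}} := fun p =>
  `[< exists c : 'I_n -> {mpoly int[n]}, p = \sum_i c i * habiro_gen N i >].

Lemma habiro_idealP N (p : {mpoly int[n]}) :
  reflect (exists c : 'I_n -> {mpoly int[n]}, p = \sum_i c i * habiro_gen N i)
          (p \in habiro_ideal N).
Proof. exact: asboolP. Qed.

Lemma habiro_ideal_idealr_closed N : idealr_closed (habiro_ideal N.+1).
Proof.
split.
- by apply/habiro_idealP; exists (fun=> 0); rewrite big1 // => i _; rewrite mul0r.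
- apply/negP => /habiro_idealP [c /(congr1 (meval (fun=> 1)))].
  rewrite rmorph1 rmorph_sum big1 ?(rwP eqP) //= => i _.
  rewrite rmorphM /habiro_gen rmorph_prod big_ltn //= rmorphB /= expr1 mevalXU.
  by rewrite rmorph1 subrr mul0r mulr0.
move=> a p q /habiro_idealP[c ->] /habiro_idealP[d ->].
apply/habiro_idealP; exists (fun i => a * c i + d i).
rewrite mulr_sumr -big_split /=; apply: eq_bigr => i _.
by rewrite mulrDl mulrA.
Qed.

HB.instance Definition _ N :=
  isIdealr.Build {mpoly int[n]} (habiro_ideal N.+1)
    (habiro_ideal_idealr_closed N).

Lemma habiro_ideal_decr N : {subset habiro_ideal N.+1 <= habiro_ideal N}.
Proof.
move=> p /habiro_idealP[c ->]; apply/habiro_idealP.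
exists (fun i => c i * ('X_i ^+ N.+1 - 1)); apply: eq_bigr => i _.
by rewrite /habiro_gen big_nat_recr //= -mulrA [_ * (_ - 1)]mulrC mulrA.
Qed.

(* The index is shifted because I_(n,0) is not a proper ideal (for n > 0), which
   the library requires; dropping the term N = 0 does not change the limit. *)
Definition habiro_quot (N : nat) := {ideal_quot (habiro_ideal N.+1)}.

HB.instance Definition _ N := GRing.ComNzRing.on (habiro_quot N).

Definition habiro_class (N : nat) (p : {mpoly int[n]}) : habiro_quot N :=
  \pi_({ideal_quot (habiro_ideal N.+1)}) p.

Lemma habiro_class_zmod_morphism N : zmod_morphism (habiro_class N).
Proof. by move=> p q; rewrite /habiro_class rmorphB. Qed.

Lemma habiro_class_monoid_morphism N : monoid_morphism (habiro_class N).
Proof. by split=> [|p q]; rewrite /habiro_class ?rmorph1 ?rmorphM. Qed.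

HB.instance Definition _ N := GRing.isZmodMorphism.Build
  {mpoly int[n]} (habiro_quot N) (habiro_class N) (habiro_class_zmod_morphism N).
HB.instance Definition _ N := GRing.isMonoidMorphism.Build
  {mpoly int[n]} (habiro_quot N) (habiro_class N) (habiro_class_monoid_morphism N).

Lemma habiro_classP N (x : habiro_quot N) : exists p, x = habiro_class N p.
Proof. by exists (repr x); rewrite /habiro_class reprK. Qed.

Lemma habiro_class_eq N p q :
  (habiro_class N p == habiro_class N q) = (p - q \in habiro_ideal N.+1).
Proof. by rewrite /habiro_class -(@Quotient.idealrBE {mpoly int[n]} (habiro_ideal N.+1)). Qed.

Definition habiro_trans (N : nat) (x : habiro_quot N.+1) : habiro_quot N :=
  habiro_class N (repr x).

Lemma habiro_trans_class N p :
  habiro_trans (habiro_class N.+1 p) = habiro_class N p.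
Proof.
apply/eqP; rewrite habiro_class_eq habiro_ideal_decr // -habiro_class_eq.
by rewrite /habiro_class reprK.
Qed.

Lemma habiro_trans_zmod_morphism N : zmod_morphism (@habiro_trans N).
Proof.
move=> x y; have [p ->] := habiro_classP x; have [q ->] := habiro_classP y.
by rewrite -rmorphB !habiro_trans_class rmorphB.
Qed.

Lemma habiro_trans_monoid_morphism N : monoid_morphism (@habiro_trans N).
Proof.
split=> [|x y]; first by rewrite -(rmorph1 (habiro_class N.+1)) habiro_trans_class rmorph1.
have [p ->] := habiro_classP x; have [q ->] := habiro_classP y.
by rewrite -rmorphM !habiro_trans_class rmorphM.
Qed.

HB.instance Definition _ N := GRing.isZmodMorphism.Build
  (habiro_quot N.+1) (habiro_quot N) (@habiro_trans N)
  (@habiro_trans_zmod_morphism N).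
HB.instance Definition _ N := GRing.isMonoidMorphism.Build
  (habiro_quot N.+1) (habiro_quot N) (@habiro_trans N)
  (@habiro_trans_monoid_morphism N).

(* The inverse limit: compatible sequences of residue classes. *)
Record habiro : Type := Habiro {
  hproj : forall N, habiro_quot N;
  hprojS : forall N, habiro_trans (hproj N.+1) = hproj N
}.

Lemma habiroP (f g : habiro) : (forall N, hproj f N = hproj g N) -> f = g.
Proof.
case: f g => [f hf] [g hg] /= fg; have {}fg : f = g by apply: functional_extensionality_dep.
by subst g; rewrite (Prop_irrelevance hf hg).
Qed.

HB.instance Definition _ := gen_eqMixin habiro.
HB.instance Definition _ := gen_choiceMixin habiro.

Program Definition habiro0 := @Habiro (fun=> 0) _.
Next Obligation. exact: rmorph0. Qed.
Program Definition habiro1 := @Habiro (fun=> 1) _.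
Next Obligation. exact: rmorph1. Qed.
Program Definition habiro_opp (f : habiro) := @Habiro (fun N => - hproj f N) _.
Next Obligation. by rewrite rmorphN /= hprojS. Qed.
Program Definition habiro_add (f g : habiro) :=
  @Habiro (fun N => hproj f N + hproj g N) _.
Next Obligation. by rewrite rmorphD /= !hprojS. Qed.
Program Definition habiro_mul (f g : habiro) :=
  @Habiro (fun N => hproj f N * hproj g N) _.
Next Obligation. by rewrite rmorphM /= !hprojS. Qed.

Lemma habiro_addA : associative habiro_add.
Proof. by move=> f g h; apply: habiroP => N /=; rewrite addrA. Qed.
Lemma habiro_addC : commutative habiro_add.
Proof. by move=> f g; apply: habiroP => N /=; rewrite addrC. Qed.
Lemma habiro_add0 : left_id habiro0 habiro_add.
Proof. by move=> f; apply: habiroP => N /=; rewrite add0r. Qed.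
Lemma habiro_addN : left_inverse habiro0 habiro_opp habiro_add.
Proof. by move=> f; apply: habiroP => N /=; rewrite addNr. Qed.

HB.instance Definition _ := GRing.isZmodule.Build habiro
  habiro_addA habiro_addC habiro_add0 habiro_addN.

Lemma habiro_mulA : associative habiro_mul.
Proof. by move=> f g h; apply: habiroP => N /=; rewrite mulrA. Qed.
Lemma habiro_mulC : commutative habiro_mul.
Proof. by move=> f g; apply: habiroP => N /=; rewrite mulrC. Qed.
Lemma habiro_mul1 : left_id habiro1 habiro_mul.
Proof. by move=> f; apply: habiroP => N /=; rewrite mul1r. Qed.
Lemma habiro_mulDl : left_distributive habiro_mul +%R.
Proof. by move=> f g h; apply: habiroP => N /=; rewrite mulrDl. Qed.
Lemma habiro_oner_neq0 : habiro1 != 0.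
Proof.
by apply/eqP => /(congr1 (hproj^~ 0%N)) /= /eqP; rewrite oner_eq0.
Qed.

HB.instance Definition _ := GRing.Zmodule_isComNzRing.Build habiro
  habiro_mulA habiro_mulC habiro_mul1 habiro_mulDl habiro_oner_neq0.

HB.instance Definition _ := GRing.ComNzRing_hasMulInverse.Build habiro
  (@cmulVx habiro) (@cunitP habiro) (@cinv_out habiro).

Definition habiro_poly (p : {mpoly int[n]}) : habiro :=
  @Habiro (fun N => habiro_class N p) (fun N => habiro_trans_class N p).

Lemma habiro_poly_zmod_morphism : zmod_morphism habiro_poly.
Proof. by move=> p q; apply: habiroP => N /=; rewrite rmorphB. Qed.

Lemma habiro_poly_monoid_morphism : monoid_morphism habiro_poly.
Proof.
by split=> [|p q]; apply: habiroP => N /=; rewrite ?rmorph1 ?rmorphM.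
Qed.

HB.instance Definition _ := GRing.isZmodMorphism.Build
  {mpoly int[n]} habiro habiro_poly habiro_poly_zmod_morphism.
HB.instance Definition _ := GRing.isMonoidMorphism.Build
  {mpoly int[n]} habiro habiro_poly habiro_poly_monoid_morphism.

Lemma habiro_gen_mod_X N i :
  exists r, habiro_gen N i = (-1) ^+ N + 'X_i * r.
Proof.
elim: N => [|N [r IH]].
  by exists 0; rewrite /habiro_gen big_geq // mulr0 addr0.
rewrite /habiro_gen big_nat_recr //= -/(habiro_gen N i) IH.
exists ('X_i ^+ N * ((-1) ^+ N + 'X_i * r) - r).
by rewrite !exprS; ring.
Qed.

Lemma habiro_class_X_inv N i : exists y, y * habiro_class N 'X_i = 1.
Proof.
have [r hr] := habiro_gen_mod_X N.+1 i.
exists (habiro_class N ((-1) ^+ N * r)); rewrite -rmorphM.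
apply/eqP; rewrite -(rmorph1 (habiro_class N)) habiro_class_eq.
apply/habiro_idealP; exists (fun j => (-1) ^+ N *+ (j == i)).
rewrite (bigD1 i) //= eqxx mulr1n big1 ?addr0 => [|j /negPf->]; last by rewrite mul0r.
rewrite hr mulrDr exprS mulN1r mulrN -expr2 sqrr_sign addrC.
by rewrite -mulrA [r * _]mulrC.
Qed.

Lemma habiro_X_unit i : habiro_poly 'X_i \is a GRing.unit.
Proof.
pose y N := projT1 (cid (habiro_class_X_inv N i)).
have yE N : y N * habiro_class N 'X_i = 1 by rewrite /y; case: cid.
have yS N : habiro_trans (y N.+1) = y N.
  have := congr1 (@habiro_trans N) (yE N.+1).
  rewrite rmorphM rmorph1 /= habiro_trans_class => h.
  by rewrite -[LHS]mulr1 -(yE N) mulrCA mulrC h mul1r.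
by apply/asboolP; exists (Habiro yS); apply: habiroP.
Qed.

(* The canonical map of the Laurent polynomial ring to the Habiro ring, i.e. the
   extension of habiro_poly given by the invertibility of the q_i. *)
Definition habiro_laurent : laurent n -> habiro :=
  leval (fun i => habiro_poly 'X_i).

HB.instance Definition _ := GRing.Additive.on habiro_laurent.
HB.instance Definition _ :=
  GRing.isMonoidMorphism.Build (laurent n) habiro habiro_laurent
    (leval_monoid_morphism habiro_X_unit).

Lemma habiro_laurent_lvar i : habiro_laurent (lvar i) = habiro_poly 'X_i.
Proof. exact: leval_lvar. Qed.

(* Continuity of an additive map for the inverse limit topology, in which the
   kernels of the projections form a basis of neighbourhoods of 0. *)
Definition habiro_continuous (S : habiro -> habiro) : Prop :=
  forall N, exists M, forall f g : habiro,
    hproj f M = hproj g M -> hproj (S f) N = hproj (S g) N.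

Definition induces_on_habiro (s : laurent n -> laurent n)
    (S : habiro -> habiro) : Prop :=
  (forall x, S (habiro_laurent x) = habiro_laurent (s x)) /\
  habiro_continuous S.

End HabiroIdeal.

(* Main.v *)
Require Import Defs.
From mathcomp Require Import all_boot all_order all_algebra.
From HB Require Import structures.
From mathcomp Require Import finmap mpoly boolp ring.
From mathcomp Require monalg.

Import Order.TTheory GRing.Theory Num.Theory.
Local Open Scope ring_scope.

(** Write (x)_N for the product of the x ^ k - 1, 1 <= k <= N.  The point is
    that an element x of a commutative ring satisfies (x)_N = 0 for some N if
    and only if it is quasi-unipotent, i.e. x ^ L - 1 is nilpotent for some
    L > 0 ([quasi_unipotent_qfact], [qfact_quasi_unipotent]): (x)_N divides
    (x ^ N! - 1) ^ N, and (x ^ L - 1) ^ m divides (x)_(mL).  Quasi-unipotence is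
    stable under products, because a sum of two nilpotent elements is nilpotent,
    and under inverses.  Since (q_i)_(N+1) = 0 in the residue ring at level N,
    every Laurent monomial in the q_i is quasi-unipotent there
    ([quasi_unipotent_habiro_lmonom]).

    Let phi be the ring homomorphism sending the polynomial p to the value of p
    at q ^ alpha in the Habiro ring.  By the above, for each N there is an M
    such that phi, read at level N, kills the ideal I_(n,M+1)
    ([habiro_ext_modulus]).  Hence phi extends continuously to the Habiro ring:
    at level N, the value on f is the value of phi on any polynomial congruent
    to f at level M.  The extension is compatible with sigma because both
    composites are ring homomorphisms on Laurent polynomials with the same
    values on the q_i.  It is unique because polynomials are dense in the Habiro
    ring ([habiro_continuous_ext]). *)

Set Implicit Arguments.
Unset Strict Implicit.
Unset Printing Implicit Defensive.

(** * Quasi-unipotent elements *)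

Section QuasiUnipotent.
Variable R : comNzRingType.
Implicit Types x y : R.

(** The product (x - 1)(x ^ 2 - 1) ... (x ^ N - 1). *)
Definition qfact (N : nat) x : R := \prod_(1 <= k < N.+1) (x ^+ k - 1).

(** Some positive power of x is unipotent; the exponent is written L.+1 to make
    it positive. *)
Definition quasi_unipotent x : Prop :=
  exists L m : nat, (x ^+ L.+1 - 1) ^+ m = 0.

Lemma qfactS N x : qfact N.+1 x = qfact N x * (x ^+ N.+1 - 1).
Proof. by rewrite /qfact big_nat_recr. Qed.

Lemma qfact_dvd M N x : (M <= N)%N -> exists c, qfact N x = c * qfact M x.
Proof.
move=> leMN; exists (\prod_(M.+1 <= k < N.+1) (x ^+ k - 1)).
by rewrite mulrC /qfact -big_cat_nat.
Qed.

Lemma expr_sub1_dvd k L x : (k %| L)%N ->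
  exists c, x ^+ L - 1 = c * (x ^+ k - 1).
Proof.
move=> /dvdnP[d ->]; exists (\sum_(i < d) (x ^+ k) ^+ i).
by rewrite mulrC -subrX1 -exprM mulnC.
Qed.

Lemma quasi_unipotent_qfact N x : qfact N x = 0 -> quasi_unipotent x.
Proof.
move=> x0; exists N`!.-1, N; rewrite prednK ?fact_gt0 //.
suff H j : (j <= N)%N -> exists c, (x ^+ N`! - 1) ^+ j = c * qfact j x.
  by have [c ->] := H N (leqnn N); rewrite x0 mulr0.
elim: j => [|j IH] ltjN.
  by exists 1; rewrite expr0 /qfact big_geq // mulr1.
have [c cE] := IH (ltnW ltjN).
have [d dE] : exists d, x ^+ N`! - 1 = d * (x ^+ j.+1 - 1).
  by apply: expr_sub1_dvd; rewrite dvdn_fact.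
by exists (c * d); rewrite exprSr cE dE qfactS mulrACA.
Qed.

Lemma qfact_quasi_unipotent x :
  quasi_unipotent x -> exists N, qfact N x = 0.
Proof.
move=> [L [m xLm]]; exists (m * L.+1)%N.
suff [c ->] : exists c, qfact (m * L.+1) x = c * (x ^+ L.+1 - 1) ^+ m.
  by rewrite xLm mulr0.
elim: m {xLm} => [|m [c IH]].
  by exists 1; rewrite mul0n /qfact big_geq // expr0 mulr1.
rewrite mulSn addSn qfactS -addSn -mulSn.
have [d ->] := @qfact_dvd (m * L.+1) (L + m * L.+1) x (leq_addl _ _).
have [e ->] := @expr_sub1_dvd L.+1 (m.+1 * L.+1) x (dvdn_mull _ (dvdnn _)).
by exists (d * c * e); rewrite IH [(_ - 1) ^+ m.+1]exprSr; ring.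
Qed.

Lemma nilpotentD x y m p :
  x ^+ m = 0 -> y ^+ p = 0 -> (x + y) ^+ (m + p) = 0.
Proof.
move=> xm yp; rewrite exprDn big1 // => i _.
have [lepi|ltip] := leqP p i.
  by rewrite -(subnK lepi) [y ^+ _]exprD yp !mulr0 mul0rn.
have lem : (m <= m + p - i)%N by rewrite -addnBA ?leq_addr // ltnW.
by rewrite -(subnK lem) exprD xm mulr0 mul0r mul0rn.
Qed.

Lemma quasi_unipotentM x y :
  quasi_unipotent x -> quasi_unipotent y -> quasi_unipotent (x * y).
Proof.
move=> [L [m xLm]] [K [p yKp]].
exists (L.+1 * K.+1).-1, (m + p)%N; rewrite prednK ?muln_gt0 //.
have [c cE] := @expr_sub1_dvd L.+1 (L.+1 * K.+1) x (dvdn_mulr _ (dvdnn _)).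
have [d dE] := @expr_sub1_dvd K.+1 (L.+1 * K.+1) y (dvdn_mull _ (dvdnn _)).
(* With e the common exponent, x^e y^e - 1 = x^e (y^e - 1) + (x^e - 1) is a sum
   of two nilpotent elements. *)
have -> : (x * y) ^+ (L.+1 * K.+1) - 1 =
    x ^+ (L.+1 * K.+1) * (y ^+ (L.+1 * K.+1) - 1) + (x ^+ (L.+1 * K.+1) - 1).
  by rewrite exprMn; ring.
rewrite addrC; apply: nilpotentD; first by rewrite cE exprMn xLm mulr0.
by rewrite dE !exprMn yKp !mulr0.
Qed.

Lemma quasi_unipotent1 : quasi_unipotent 1.
Proof. by exists 0%N, 1%N; rewrite !expr1 subrr. Qed.

Lemma quasi_unipotentX x k : quasi_unipotent x -> quasi_unipotent (x ^+ k).
Proof.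
move=> ux; elim: k => [|k IH]; first by rewrite expr0; apply: quasi_unipotent1.
by rewrite exprS; apply: quasi_unipotentM.
Qed.

Lemma quasi_unipotent_inv x y :
  x * y = 1 -> quasi_unipotent x -> quasi_unipotent y.
Proof.
move=> xy [L [m xLm]]; exists L, m.
have -> : y ^+ L.+1 - 1 = - y ^+ L.+1 * (x ^+ L.+1 - 1).
  by rewrite mulrBr mulNr -exprMn [y * x]mulrC xy expr1n mulr1 opprK addrC.
by rewrite exprMn xLm mulr0.
Qed.

Lemma quasi_unipotent_prod (I : finType) (F : I -> R) :
  (forall i, quasi_unipotent (F i)) -> quasi_unipotent (\prod_i F i).
Proof.
move=> uF; apply: (big_ind quasi_unipotent) => //.
  exact: quasi_unipotent1.
exact: quasi_unipotentM.
Qed.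

End QuasiUnipotent.

Lemma quasi_unipotentXz (A : comUnitRingType) (B : comNzRingType)
    (f : {rmorphism A -> B}) (x : A) (z : int) :
  x \is a GRing.unit -> quasi_unipotent (f x) -> quasi_unipotent (f (x ^ z)).
Proof.
move=> xU ux; case: (intP z) => [|m|m].
- by rewrite expr0z rmorph1; apply: quasi_unipotent1.
- by rewrite -exprnP rmorphXn; apply: quasi_unipotentX.
- rewrite -exprnN; apply: (@quasi_unipotent_inv _ (f x ^+ m.+1)).
    by rewrite -rmorphXn -rmorphM divrr ?rmorph1 // unitrX.
  exact: quasi_unipotentX.
Qed.

(** * Ring homomorphisms determined by the images of the variables *)

Lemma mpoly_int_rmorph_ext n (A : comNzRingType)
    (f g : {rmorphism {mpoly int[n]} -> A}) :
  (forall i, f 'X_i = g 'X_i) -> f =1 g.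
Proof.
move=> fg p; rewrite [p]mpolyE !rmorph_sum; apply: eq_bigr => m _ /=.
rewrite -mul_mpolyC -[p@_m]intz !rmorphM [_%:MP]rmorph_int !rmorph_int.
by rewrite mpolyXE_id !rmorph_prod; congr (_ * _); apply: eq_bigr => i _;
  rewrite !rmorphXn fg.
Qed.

Section LaurentExt.
Import monalg.

Lemma laurentE n (x : laurent n) :
  x = \sum_(k <- msupp x) lmonom k *~ mcoeff k x.
Proof.
rewrite {1}[x : {malg int['rV[int]_n]}]monalgE; apply: eq_bigr => k _.
rewrite -[mcoeff k x in LHS]intz.
exact: (raddfMz (mkmalgU k) (mcoeff k x) 1).
Qed.

End LaurentExt.

Lemma laurent_rmorph_ext n (A : comUnitRingType)
    (f g : {rmorphism laurent n -> A}) :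
  (forall i, f (lvar i) = g (lvar i)) -> f =1 g.
Proof.
move=> fg x; rewrite (laurentE x) !rmorph_sum; apply: eq_bigr => k _ /=.
rewrite !rmorphMz lmonomE !rmorph_prod; congr (_ *~ _).
by apply: eq_bigr => i _ /=; rewrite !rmorphXz ?lvar_unit // fg.
Qed.

(** * Projections of the Habiro ring *)

Section HabiroCoord.
Variable n : nat.

(** The projection [hproj] to the level N, with the level as first argument so
    that it is a ring homomorphism in the remaining one. *)
Definition habiro_coord (N : nat) (f : habiro n) : habiro_quot n N := hproj f N.

Lemma habiro_coord_zmod_morphism N : zmod_morphism (habiro_coord N).
Proof. by []. Qed.

Lemma habiro_coord_monoid_morphism N : monoid_morphism (habiro_coord N).
Proof. by []. Qed.

HB.instance Definition _ N := GRing.isZmodMorphism.Build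
  (habiro n) (habiro_quot n N) (habiro_coord N) (habiro_coord_zmod_morphism N).
HB.instance Definition _ N := GRing.isMonoidMorphism.Build
  (habiro n) (habiro_quot n N) (habiro_coord N)
  (habiro_coord_monoid_morphism N).

Lemma hproj_le (f g : habiro n) M N : (M <= N)%N ->
  hproj f N = hproj g N -> hproj f M = hproj g M.
Proof.
move=> /subnK <-; elim: (N - M)%N => [|d IH] //= fg; apply: IH.
by rewrite -[LHS]hprojS -[RHS]hprojS fg.
Qed.

Lemma habiro_poly_dense (f : habiro n) N :
  exists p, hproj f N = hproj (habiro_poly p) N.
Proof. exact: habiro_classP. Qed.

(** This is the defining relation of level N, where the ideal is I_(n,N+1). *)
Lemma qfact_habiro_X N i :
  qfact N.+1 (habiro_coord N (habiro_poly 'X_i)) = 0.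
Proof.
transitivity (habiro_class N (habiro_gen N.+1 i)).
  rewrite rmorph_prod; apply: eq_bigr => k _ /=.
  by rewrite rmorphB rmorphXn rmorph1.
apply/eqP; rewrite -(rmorph0 (habiro_class N)) habiro_class_eq subr0.
apply/habiro_idealP; exists (fun j => (j == i)%:R).
rewrite (bigD1 i) //= eqxx mul1r big1 ?addr0 // => j /negPf ->.
by rewrite mul0r.
Qed.

Lemma quasi_unipotent_habiro_lmonom N (k : 'rV[int]_n) :
  quasi_unipotent (habiro_coord N (habiro_laurent (lmonom k))).
Proof.
rewrite lmonomE !rmorph_prod; apply: quasi_unipotent_prod => i /=.
pose c : {rmorphism laurent n -> habiro_quot n N} :=
  habiro_coord N \o @habiro_laurent n.
apply: (@quasi_unipotentXz _ _ c (lvar i)).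
  exact: lvar_unit.
rewrite /c /= habiro_laurent_lvar.
exact: quasi_unipotent_qfact (qfact_habiro_X N i).
Qed.

End HabiroCoord.

(** * Continuous extension from polynomials to the Habiro ring *)

Section HabiroExtension.
Variables (n : nat) (phi : {rmorphism {mpoly int[n]} -> habiro n}).

Hypothesis phiU :
  forall N i, quasi_unipotent (habiro_coord N (phi 'X_i)).

(** This is the continuity of phi for the topology defined by the ideals
    I_(n,M). *)
Lemma habiro_ext_modulus N : exists M, forall p q,
  habiro_class M p = habiro_class M q -> hproj (phi p) N = hproj (phi q) N.
Proof.
pose K i := projT1 (cid (qfact_quasi_unipotent (phiU N i))).
have K0 i : qfact (K i) (habiro_coord N (phi 'X_i)) = 0.
  by rewrite /K; case: cid.
exists (\max_i K i)%N => p q /eqP; rewrite habiro_class_eq.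
move=> /habiro_idealP[c pq].
apply/eqP; rewrite -subr_eq0 -[_ - _]/(habiro_coord N (phi p - phi q)).
rewrite -rmorphB pq.
rewrite !rmorph_sum big1 // => i _ /=; rewrite !rmorphM /=.
have -> : habiro_coord N (phi (habiro_gen (\max_i K i).+1 i)) =
    qfact (\max_i K i).+1 (habiro_coord N (phi 'X_i)).
  rewrite !rmorph_prod; apply: eq_bigr => k _ /=.
  by rewrite !rmorphB !rmorphXn !rmorph1.
have [d ->] := @qfact_dvd _ (K i) (\max_i K i).+1 (habiro_coord N (phi 'X_i))
  (leqW (leq_bigmax i)).
by rewrite K0 !mulr0.
Qed.

(** A chosen level of the argument that determines the level N of the value of
    phi. *)
Definition ext_modulus N : nat := projT1 (cid (habiro_ext_modulus N)).

(** The level N of the extension of phi at f, computed with the chosen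
    representative of f at level [ext_modulus N]; by [habiro_ext_projE] any
    other representative gives the same value. *)
Definition habiro_ext_proj (f : habiro n) N : habiro_quot n N :=
  hproj (phi (repr (hproj f (ext_modulus N)))) N.

Lemma habiro_ext_projE f p N :
  hproj f (ext_modulus N) = hproj (habiro_poly p) (ext_modulus N) ->
  habiro_ext_proj f N = hproj (phi p) N.
Proof.
rewrite /habiro_ext_proj /ext_modulus; case: cid => M /= HM fp.
by apply: HM; rewrite {1}/habiro_class reprK.
Qed.

Lemma habiro_ext_projS f N :
  habiro_trans (habiro_ext_proj f N.+1) = habiro_ext_proj f N.
Proof.
(* A polynomial close enough to f computes both levels at once, so that the
   compatibility is inherited from phi p. *)
have [p fp] := habiro_poly_dense f (maxn (ext_modulus N) (ext_modulus N.+1)).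
rewrite (@habiro_ext_projE f p N.+1) ?(@habiro_ext_projE f p N) ?hprojS //.
  exact: hproj_le (leq_maxl _ _) fp.
exact: hproj_le (leq_maxr _ _) fp.
Qed.

(** The continuous extension of phi to the Habiro ring. *)
Definition habiro_ext (f : habiro n) : habiro n := Habiro (habiro_ext_projS f).

Lemma habiro_ext_zmod_morphism : zmod_morphism habiro_ext.
Proof.
move=> f g; apply: habiroP => N /=.
have [p fp] := habiro_poly_dense f (ext_modulus N).
have [q gq] := habiro_poly_dense g (ext_modulus N).
rewrite (habiro_ext_projE fp) (habiro_ext_projE gq).
rewrite (@habiro_ext_projE _ (p - q)) ?rmorphB //.
by rewrite /= fp gq.
Qed.

Lemma habiro_ext_monoid_morphism : monoid_morphism habiro_ext.
Proof.
split=> [|f g]; apply: habiroP => N /=.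
  by rewrite (@habiro_ext_projE _ 1) ?rmorph1.
have [p fp] := habiro_poly_dense f (ext_modulus N).
have [q gq] := habiro_poly_dense g (ext_modulus N).
rewrite (habiro_ext_projE fp) (habiro_ext_projE gq).
rewrite (@habiro_ext_projE _ (p * q)) ?rmorphM //.
by rewrite /= fp gq.
Qed.

HB.instance Definition _ := GRing.isZmodMorphism.Build
  (habiro n) (habiro n) habiro_ext habiro_ext_zmod_morphism.
HB.instance Definition _ := GRing.isMonoidMorphism.Build
  (habiro n) (habiro n) habiro_ext habiro_ext_monoid_morphism.

Lemma habiro_ext_poly p : habiro_ext (habiro_poly p) = phi p.
Proof. by apply: habiroP => N /=; apply: habiro_ext_projE. Qed.

Lemma habiro_ext_continuous : habiro_continuous habiro_ext.
Proof.
by move=> N; exists (ext_modulus N) => f g /= fg; rewrite /habiro_ext_proj fg.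
Qed.

End HabiroExtension.

(** Continuous endomorphisms are determined by the images of the q_i, because
    polynomials are dense. *)
Lemma habiro_continuous_ext n (S T : {rmorphism habiro n -> habiro n}) :
    habiro_continuous S -> habiro_continuous T ->
    (forall i, S (habiro_poly 'X_i) = T (habiro_poly 'X_i)) ->
  S =1 T.
Proof.
move=> cS cT eqX f; apply: habiroP => N.
have [[M HM] [K HK]] := (cS N, cT N).
have [p fp] := habiro_poly_dense f (maxn M K).
rewrite (HM _ _ (hproj_le (leq_maxl _ _) fp)).
rewrite (HK _ _ (hproj_le (leq_maxr _ _) fp)).
have eqST := mpoly_int_rmorph_ext (f := S \o @habiro_poly n)
                                  (g := T \o @habiro_poly n) eqX.
by have /= -> := eqST p.
Qed.

Theorem proposition3p1 (n : nat) (alpha : 'M[int]_n)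
    (alpha_gt0 : 0 < \det alpha) :
  exists S : {rmorphism habiro n -> habiro n},
    induces_on_habiro (sigma alpha) S /\
    (forall S' : {rmorphism habiro n -> habiro n},
        induces_on_habiro (sigma alpha) S' -> S' =1 S).
Proof.
pose phi : {rmorphism {mpoly int[n]} -> habiro n} :=
  mmap (intr : int -> habiro n) (fun i => habiro_laurent (qpow alpha i)).
have phiX i : phi 'X_i = habiro_laurent (qpow alpha i).
  by rewrite /phi /= mmapX mmap1U.
have phiU N i : quasi_unipotent (habiro_coord N (phi 'X_i)).
  have -> : phi 'X_i = habiro_laurent (lmonom (row i alpha)).
    by rewrite phiX lmonomE /qpow; under [in RHS]eq_bigr do rewrite mxE.
  exact: quasi_unipotent_habiro_lmonom.
pose S : {rmorphism habiro n -> habiro n} := habiro_ext phiU.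
have SX i : S (habiro_poly 'X_i) = habiro_laurent (sigma alpha (lvar i)).
  by rewrite /S /= habiro_ext_poly phiX sigma_lvar.
exists S; split=> [|S' [S'E cS']].
  split; last exact: habiro_ext_continuous.
  apply: (laurent_rmorph_ext (f := S \o @habiro_laurent n)
                             (g := @habiro_laurent n \o sigma alpha)) => i.
  by rewrite /= habiro_laurent_lvar SX.
apply: habiro_continuous_ext => // [|i]; first exact: habiro_ext_continuous.
by rewrite SX -S'E habiro_laurent_lvar.
Qed.
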